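(* Let $F:\mathbb{R}^n\to\mathbb{R}^m$, $x\mapsto y$, be given in abs-normal form by $z=c+Zx+L|z|$, $y=b+Jx+Y|z|$. Let $\sigma\in\{-1,0,1\}^s$ be an open signature and $\Sigma=\mathrm{diag}(\sigma)$. Then for all $x\in P_\sigma$ the value $y=F(x)$ is given by $$y = b+Y\Sigma(I-L\Sigma)^{-1}c+J_\sigma x,\qquad J_\sigma = J+Y\Sigma(I-L\Sigma)^{-1}Z,$$ and $J_\sigma$ is the Jacobian of $F$ restricted to $P_\sigma$. If $F$ is simply switched ($\nu=1$, i.e. $L=0$), then $J_\sigma=J+Y\Sigma Z$; if $\nu=0$ (the smooth case $s=0$), then $J_\sigma=J$.
   Context: Abs-normal form: $c\in\mathbb{R}^s$, $b\in\mathbb{R}^m$, $Z\in\mathbb{R}^{s\times n}$, $L\in\mathbb{R}^{s\times s}$ strictly lower triangular, $J\in\mathbb{R}^{m\times n}$, $Y\in\mathbb{R}^{m\times s}$; $|\cdot|$ acts componentwise. For each $x\in\mathbb{R}^n$ the vector $z=z(x)\in\mathbb{R}^s$ is uniquely determined by $z=c+Zx+L|z|$ (forward substitution), and $F(x)=b+Jx+Y|z(x)|$. The switching depth $\nu$ is the smallest integer with $L^\nu=0$; $\nu=0$ means $s=0$ (then $z,Z,L$ are empty), and $F$ is simply switched if $\nu=1$, i.e. $L=0$. The signature of $x$ is $\sigma(x)=\mathrm{sign}(z(x))\in\{-1,0,1\}^s$ (componentwise), and $P_\sigma=\{x\in\mathbb{R}^n:\sigma(x)=\sigma\}$. A signature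 $\sigma$ is called open if $P_\sigma$ is nonempty and open. *)

(* Defs.v *)
From HB Require Import structures.
From mathcomp Require Import all_boot all_order all_algebra.
From mathcomp Require Import all_classical all_reals all_analysis.

Set Implicit Arguments.
Unset Strict Implicit.
Unset Printing Implicit Defensive.

Import Order.TTheory GRing.Theory Num.Theory.
Import numFieldNormedType.Exports.

Local Open Scope classical_set_scope.
Local Open Scope ring_scope.

Definition strictly_lower (R : realType) s (L : 'M[R]_s) : Prop :=
  forall i j : 'I_s, (i <= j)%N -> L i j = 0.

Definition absv (R : realType) s (z : 'cV[R]_s) : 'cV[R]_s :=
  map_mx (fun t : R => `|t|) z.

Definition sgv (R : realType) s (z : 'cV[R]_s) : 'cV[R]_s :=
  map_mx (fun t : R => Num.sg t) z.

Section SwitchingEquation.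
Variables (R : realType) (n s : nat).
Variables (c : 'cV[R]_s) (Z : 'M[R]_(s, n)) (L : 'M[R]_s).

(* The default 0 is never returned when L is strictly lower triangular, see
   [switching_vectorP] below. *)
Definition switching_vector (x : 'cV[R]_n) : 'cV[R]_s :=
  xget 0 [set z | z = c + Z *m x + L *m absv z].

Definition signature (x : 'cV[R]_n) : 'cV[R]_s := sgv (switching_vector x).

Definition signature_domain (sigma : 'cV[R]_s) : set 'cV[R]_n :=
  [set x | signature x = sigma].

Definition open_signature (sigma : 'cV[R]_s) : Prop :=
  signature_domain sigma !=set0 /\ open (signature_domain sigma).

Hypothesis hL : strictly_lower L.

Let step (x : 'cV[R]_n) (z : 'cV[R]_s) := c + Z *m x + L *m absv z.

Let step_agree x k (z w : 'cV[R]_s) (i : 'I_s) :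
  (i < k)%N -> iter k (step x) z i 0 = iter k (step x) w i 0.
Proof.
elim: k i => [//|k IH] i; rewrite ltnS => ik.
rewrite !iterS !mxE; congr (_ + _); apply: eq_bigr => j _.
have [ij|ji] := leqP i j; first by rewrite hL // !mul0r.
by rewrite !mxE (IH j) // (leq_trans ji).
Qed.

Let step_const x z w : iter s (step x) z = iter s (step x) w.
Proof. by apply/colP => i; apply: step_agree. Qed.

Lemma switching_vector_uniq x (z w : 'cV[R]_s) :
  z = c + Z *m x + L *m absv z -> w = c + Z *m x + L *m absv w -> z = w.
Proof.
have fixI u : u = step x u -> iter s (step x) u = u.
  by move=> hu; elim: (s in iter s) => // k IH; rewrite iterS IH -hu.
by move=> /fixI zE /fixI wE; rewrite -zE -wE; apply: step_const.
Qed.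

Lemma switching_vectorP x :
  switching_vector x = c + Z *m x + L *m absv (switching_vector x).
Proof.
have ex : [set z | z = step x z] (iter s (step x) 0).
  by rewrite /= -iterS iterSr; apply: step_const.
exact: (xgetPex 0 (ex_intro _ _ ex)).
Qed.

End SwitchingEquation.

Section SwitchingDepth.
Variables (R : realType) (s : nat) (L : 'M[R]_s).
Hypothesis hL : strictly_lower L.

Lemma strictly_lower_nilpotent : exists k, L ^+ k == 0.
Proof.
have H k : forall i j : 'I_s, (i < j + k)%N -> (L ^+ k) i j = 0.
  elim: k => [|k IH] i j.
    by rewrite addn0 expr0 mxE -val_eqE => /ltn_eqF ->.
  rewrite addnS ltnS => ijk; rewrite exprS mxE big1 // => l _.
  have [il|li] := leqP i l; first by rewrite hL // mul0r.
  by rewrite IH ?mulr0 // (leq_trans li).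
exists s; apply/eqP/matrixP => i j.
by rewrite H ?mxE // (leq_trans (ltn_ord i)) // leq_addl.
Qed.

Definition switching_depth : nat := ex_minn strictly_lower_nilpotent.

Definition simply_switched : Prop := switching_depth = 1%N.

Lemma switching_depth_eq0 : switching_depth = 0%N <-> s = 0%N.
Proof.
rewrite /switching_depth; case: ex_minnP => k Lk kmin; split.
  move=> k0; move: Lk; rewrite k0 expr0.
  case: (posnP s) => // s0 /eqP/matrixP/(_ (Ordinal s0) (Ordinal s0)).
  by rewrite !mxE eqxx => /eqP; rewrite oner_eq0.
move=> s0; apply/eqP; rewrite -leqn0; apply: kmin.
by apply/eqP/matrixP => i; exfalso; move: (ltn_ord i); rewrite [X in (_ < X)%N]s0.
Qed.

Lemma simply_switchedP : simply_switched <-> (0 < s)%N /\ L = 0.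
Proof.
split=> [d1|[s0 L0]].
  split.
    by rewrite lt0n; apply/eqP => /switching_depth_eq0; rewrite d1.
  move: d1; rewrite /simply_switched /switching_depth.
  by case: ex_minnP => k /eqP Lk _ k1; rewrite -Lk k1 expr1.
have d0 : switching_depth != 0%N.
  by apply/eqP => /switching_depth_eq0 s0'; rewrite s0' in s0.
apply/eqP; rewrite eqn_leq lt0n d0 andbT.
by rewrite /switching_depth; case: ex_minnP => k _; apply; rewrite expr1 L0.
Qed.

End SwitchingDepth.

Section AbsNormalForm.
Variables (R : realType) (n m s : nat).

Definition abs_normal_form (c : 'cV[R]_s) (b : 'cV[R]_m) (Z : 'M[R]_(s, n))
    (L : 'M[R]_s) (J : 'M[R]_(m, n)) (Y : 'M[R]_(m, s))
    (F : 'cV[R]_n -> 'cV[R]_m) : Prop :=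
  forall x, F x = b + J *m x + Y *m absv (switching_vector c Z L x).

(* Counterpart for column vectors of the library's [jacobian], which is the
   matrix of the differential acting on row vectors from the right. *)
Definition col_jacobian (f : 'cV[R]_n -> 'cV[R]_m) (x : 'cV[R]_n) :
    'M[R]_(m, n) :=
  \matrix_(i, j) ('d f x (delta_mx j 0)) i 0.

End AbsNormalForm.

(* Main.v *)
Require Import Defs.
From HB Require Import structures.
From mathcomp Require Import all_boot all_order all_algebra.
From mathcomp Require Import all_classical all_reals all_analysis.

Set Implicit Arguments.
Unset Strict Implicit.
Unset Printing Implicit Defensive.

Import Order.TTheory GRing.Theory Num.Theory.
Import numFieldNormedType.Exports.

Local Open Scope classical_set_scope.
Local Open Scope ring_scope.

(** The only nonlinearity of an abs-normal form is the map [|z|], and on a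
    signature domain the signs of [z] are those of [sigma], so that there
    [|z| = Sigma z] with [Sigma = diag sigma] ([absv_sgv]).  The switching
    equation then reads [(I - L Sigma) z = c + Z x].  As [L Sigma] inherits the
    strict lower triangularity of [L], the matrix [I - L Sigma] is unit lower
    triangular, hence invertible, and [z] is the affine function
    [(I - L Sigma)^-1 (c + Z x)] of [x] ([switching_vector_signature]).
    Substituting this into [y = b + J x + Y |z|] gives the formula for [F].

    Since the signature is open, the formula holds on a neighbourhood of each
    point of the domain, so that [F] is differentiable there as a map on the
    whole space, with the linear part of the formula as its differential
    ([near_affine_is_diff]).  The two special cases are algebra: for [nu = 1] the
    matrix [I - L Sigma] is the identity, and for [nu = 0] the product
    [Y Sigma] runs through a space of dimension [0]. *)

Lemma absv_sgv (R : realType) s (z : 'cV[R]_s) :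
  absv z = diag_mx (sgv z)^T *m z.
Proof. by apply/colP => i; rewrite mul_diag_mx !mxE normrEsg. Qed.

(** The matrix is triangular with unit diagonal, so its determinant is 1. *)
Lemma unitmx_1sub_strictly_lower (R : realType) s (A : 'M[R]_s) :
  strictly_lower A -> 1%:M - A \in unitmx.
Proof.
move=> hA; rewrite unitmxE det_trig; last first.
  apply/is_trig_mxP => i j ij.
  by rewrite !mxE hA ?(ltnW ij)// -val_eqE (ltn_eqF ij) subr0.
by rewrite big1 ?unitr1// => i _; rewrite !mxE eqxx hA// subr0.
Qed.

Lemma strictly_lower_mul_diag (R : realType) s (L : 'M[R]_s) (d : 'rV[R]_s) :
  strictly_lower L -> strictly_lower (L *m diag_mx d).
Proof. by move=> hL i j ij; rewrite mul_mx_diag mxE hL// mul0r. Qed.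

(** Where the signs of [z] are known, the absolute value is linear, and
    forward substitution becomes the solution of a linear system. *)
Lemma switching_vector_signature (R : realType) n s (c : 'cV[R]_s)
    (Z : 'M[R]_(s, n)) (L : 'M[R]_s) (hL : strictly_lower L)
    (sigma : 'cV[R]_s) (x : 'cV[R]_n) :
  signature_domain c Z L sigma x ->
  switching_vector c Z L x =
    invmx (1%:M - L *m diag_mx sigma^T) *m (c + Z *m x).
Proof.
move=> sx; have := switching_vectorP c Z hL x.
rewrite absv_sgv -/(signature c Z L x) sx.
set z := switching_vector c Z L x => zE.
have uM := unitmx_1sub_strictly_lower (strictly_lower_mul_diag sigma^T hL).
apply: (can_inj (mulKmx uM)); rewrite mulKVmx//.
by rewrite mulmxBl mul1mx -mulmxA [X in X - _]zE addrK.
Qed.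

(** A matrix product is a finite sum of coordinates times fixed columns, and
    the coordinates are continuous. *)
Lemma mulmx_col_continuous (R : realType) m n (A : 'M[R]_(m, n)) :
  continuous (mulmx A : 'cV[R]_n -> 'cV[R]_m).
Proof.
have -> : (mulmx A : 'cV[R]_n -> 'cV[R]_m) =
    (fun x => \sum_j x j 0 *: col j A).
  apply/funext => x; apply/colP => i; rewrite mxE summxE.
  by apply: eq_bigr => j _; rewrite !mxE mulrC.
apply: (continuous_big add_continuous) => j _ x.
exact: (cvgZr_tmp (@coord_continuous _ _ _ j 0 x)).
Qed.

(** The remainder of the first-order expansion vanishes identically near [x],
    so that it is little-o of the increment. *)
Lemma near_affine_is_diff (R : realType) (V W : normedModType R) (f : V -> W)
    (df : {linear V -> W}) (x : V) :
  continuous df -> (\forall y \near x, f y = f x + df (y - x)) ->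
  is_diff x f df.
Proof.
move=> dfc fE.
have fx : f \o shift x = cst (f x) + df +o_ 0 id.
  apply/eqaddoP => e e0.
  have fE0 : \forall h \near (0 : V), f (h + x) = f x + df (h + x - x).
    by have := fE; rewrite (near_shift 0 x) /= subr0.
  apply: filterS fE0 => h hE.
  rewrite [X in `|X|](_ : _ = 0) ?normr0 ?mulr_ge0 ?(ltW e0)//.
  rewrite -[LHS]/(f (h + x) - (f x + df h)).
  by rewrite hE addrK subrr.
have dE := diff_unique dfc fx.
by apply: DiffDef => //; apply/diff_locallyP; rewrite dE.
Qed.

Lemma col_jacobian_is_diff (R : realType) n m (f : 'cV[R]_n -> 'cV[R]_m)
    (A : 'M[R]_(m, n)) (x : 'cV[R]_n) :
  is_diff x f (mulmx A) -> col_jacobian f x = A.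
Proof.
by move=> fA; apply/matrixP => i j; rewrite mxE diff_val -colE mxE.
Qed.

Theorem proposition3p1 (R : realType) (n m s : nat)
    (c : 'cV[R]_s) (b : 'cV[R]_m) (Z : 'M[R]_(s, n)) (L : 'M[R]_s)
    (J : 'M[R]_(m, n)) (Y : 'M[R]_(m, s)) (hL : strictly_lower L)
    (F : 'cV[R]_n -> 'cV[R]_m) (hF : abs_normal_form c b Z L J Y F)
    (sigma : 'cV[R]_s)
    (hsigma : forall i, sigma i 0 \in [:: -1; 0; 1])
    (sigma_open : open_signature c Z L sigma) :
  let Sigma := diag_mx sigma^T in
  let Jsigma := J + Y *m Sigma *m invmx (1%:M - L *m Sigma) *m Z in
  [/\ 1%:M - L *m Sigma \in unitmx,
      forall x, signature_domain c Z L sigma x ->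
        F x = b + Y *m Sigma *m invmx (1%:M - L *m Sigma) *m c + Jsigma *m x,
      forall x, signature_domain c Z L sigma x ->
        differentiable F x /\ col_jacobian F x = Jsigma,
      simply_switched hL -> Jsigma = J + Y *m Sigma *m Z &
      switching_depth hL = 0%N -> Jsigma = J].
Proof.
move=> Sigma Jsigma.
have uM : 1%:M - L *m Sigma \in unitmx.
  exact/unitmx_1sub_strictly_lower/strictly_lower_mul_diag.
have FE x : signature_domain c Z L sigma x ->
    F x = b + Y *m Sigma *m invmx (1%:M - L *m Sigma) *m c + Jsigma *m x.
  move=> sx; rewrite hF absv_sgv -/(signature c Z L x) sx.
  rewrite (switching_vector_signature hL sx) -/Sigma /Jsigma.
  by rewrite mulmxDl !mulmxDr !mulmxA -!addrA; congr (_ + _); rewrite addrCA.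
have FJ x : signature_domain c Z L sigma x -> is_diff x F (mulmx Jsigma).
  move=> sx; apply: near_affine_is_diff; first exact: mulmx_col_continuous.
  have sigma_nbhs := open_nbhs_nbhs (conj sigma_open.2 sx).
  apply: filterS sigma_nbhs => y sy.
  by rewrite (FE _ sy) (FE _ sx) -[in LHS](subrKC x y) mulmxDr addrA.
split=> //.
- by move=> x /FJ Fx; split; [exact: ex_diff | exact: col_jacobian_is_diff].
- move=> /simply_switchedP[_ L0].
  by rewrite /Jsigma L0 mul0mx subr0 invmx1 mulmx1.
- move=> /switching_depth_eq0 s0.
  (* [Y] has no columns. *)
  rewrite /Jsigma [Y](_ : _ = 0) ?mul0mx ?addr0//.
  by apply/matrixP => i j; move: (ltn_ord j); rewrite [X in (_ < X)%N]s0.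
Qed.
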